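(* Let $R$ be an integral domain. Then $R$ is a discrete valuation ring (DVR) if and only if $R$ is a Dedekind domain with a unique nonzero prime ideal.
   Context: All rings are commutative with unity. A discrete valuation of a field $K$ is a surjective group homomorphism $v\colon K^\times \to \mathbb{Z}$ (from the multiplicative group of $K$ to the additive group $\mathbb{Z}$) such that $v(x+y)\ge \min\{v(x),v(y)\}$ for all $x,y\in K^\times$ with $x+y\neq 0$; by convention $v(0)=\infty$. A discrete valuation ring (DVR) is any ring of the form $\mathcal{O}_v=\{x\in K \mid v(x)\ge 0\}$, where $K$ is a field and $v$ is a discrete valuation of $K$. A Dedekind domain is an integral domain that is Noetherian, integrally closed in its fraction field, and in which every nonzero prime ideal is maximal (fields are regarded as Dedekind domains). ''A unique nonzero prime ideal'' means that exactly one nonzero prime ideal exists. *)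

(* Defs.v *)
From HB Require Import structures.
From mathcomp Require Import all_boot all_order all_algebra.
From mathcomp Require Import boolp classical_sets.

Set Implicit Arguments.
Unset Strict Implicit.
Unset Printing Implicit Defensive.

Import Order.TTheory GRing.Theory Num.Theory.

Local Open Scope classical_set_scope.
Local Open Scope ring_scope.

(* The ideals of ring_quotient are boolean predicates and always proper;
   arbitrary ideals, possibly the whole ring, are needed here. *)
Definition is_ideal (R : comPzRingType) (I : set R) : Prop :=
  [/\ I 0,
      forall x y : R, I x -> I y -> I (x + y)
    & forall a x : R, I x -> I (a * x)].

Definition prime_ideal (R : comPzRingType) (P : set R) : Prop :=
  [/\ is_ideal P,
      P <> setT
    & forall x y : R, P (x * y) -> P x \/ P y].

Definition maximal_ideal (R : comPzRingType) (M : set R) : Prop :=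
  [/\ is_ideal M,
      M <> setT
    & forall J : set R, is_ideal J -> M `<=` J -> J = M \/ J = setT].

(* [smallest is_ideal [set` s]] is the ideal generated by the entries of [s]. *)
Definition noetherian (R : comPzRingType) : Prop :=
  forall I : set R, is_ideal I ->
    exists s : seq R, I = smallest (@is_ideal R) [set` s].

Definition integrally_closed (R : idomainType) : Prop :=
  forall x : {fraction R},
    integralOver (@tofrac R) x -> range (@tofrac R) x.

Definition dedekind_domain (R : idomainType) : Prop :=
  [/\ noetherian R,
      integrally_closed R
    & forall P : set R, prime_ideal P -> P <> [set 0] -> maximal_ideal P].

(* A valuation is a map on the nonzero elements of [K]; the value [v 0] is
   left arbitrary and is irrelevant. *)
Definition discrete_valuation (K : fieldType) (v : K -> int) : Prop :=
  [/\ forall x y : K, x != 0 -> y != 0 -> v (x * y) = v x + v y,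
      forall n : int, exists2 x : K, x != 0 & v x = n
    & forall x y : K, x != 0 -> y != 0 -> x + y != 0 ->
        Num.min (v x) (v y) <= v (x + y)].

(* The disjunct [x = 0] stands for the convention that [v 0] is infinite. *)
Definition valuation_ring (K : fieldType) (v : K -> int) : set K :=
  [set x | x = 0 \/ 0 <= v x].

(* "[R] is of the form O_v" is taken up to ring isomorphism: [f] embeds [R]
   in [K] with image O_v. *)
Definition is_dvr (R : comPzRingType) : Prop :=
  exists (K : fieldType) (v : K -> int) (f : {rmorphism R -> K}),
    [/\ discrete_valuation v, injective f & range f = valuation_ring v].

(* Main.v *)
Require Import Defs.
From mathcomp Require Import all_boot all_order all_algebra.
From mathcomp Require Import boolp classical_sets.
Local Open Scope classical_set_scope.
Local Open Scope ring_scope.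

Set Implicit Arguments.
Unset Strict Implicit.
Unset Printing Implicit Defensive.

Import Order.TTheory GRing.Theory Num.Theory.

(** Both conditions are compared with a third one, [uniformizer]: some nonzero
    nonunit [t] of [R] such that every nonzero element is a unit times a power
    of [t].

    A discrete valuation ring has such a [t], namely any element of value 1
    ([dvr_uniformizer]). Conversely a uniformizer makes every nonzero fraction
    equal to a unit of [R] times a power [t ^ n], with [n] a unique integer,
    and [n] is a discrete valuation with ring [R] ([uniformizer_dvr]).

    With a uniformizer, the nonzero ideals are the [(t ^ n)], so [R] is
    Noetherian and its only nonzero prime is [(t)]; it is integrally closed
    because of any two elements one divides the other
    ([uniformizer_dedekind_local]).

    The substance is the converse, [dedekind_local_uniformizer]. Let [M] be the
    only nonzero prime. In a Noetherian ring a maximal member of the ideals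
    [(a : b)], for [b] not in [(a)], is prime ([colon_prime]). Taking [a] a
    nonzero nonunit, this prime contains [a], so it is [M]. Hence all nonunits
    lie in [M], and, for [a] in [M], there is a fraction [x = b / a] outside
    [R] with [x M] inside [R]. If [x M] were inside [M], then [x] would be an
    eigenvalue of a matrix over [R], hence integral ([integral_stable]), and
    would lie in [R]. So [x M] contains a unit, that is, [x t] is a unit for
    some [t] in [M], which forces [M = (t)]. Finally any nonzero
    element factors into a unit and a power of [t], since otherwise dividing
    by [t] again and again would give an infinite ascending chain of principal
    ideals ([principal_factor]). *)

(** * Ideals *)

Section Ideals.
Variable R : comUnitRingType.
Implicit Types (I J : set R) (a b x t u : R).

Definition principal a : set R := [set x | exists c, x = c * a].

Definition colon a b : set R := [set c | principal a (c * b)].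

Lemma principal_ideal a : is_ideal (principal a).
Proof.
split; first by exists 0; rewrite mul0r.
- by move=> _ _ [c ->] [d ->]; exists (c + d); rewrite mulrDl.
- by move=> c _ [d ->]; exists (c * d); rewrite mulrA.
Qed.

Lemma principal_sub I a : is_ideal I -> I a -> principal a `<=` I.
Proof. by move=> [_ _ IM] Ia _ [c ->]; apply: IM. Qed.

Lemma colon_ideal a b : is_ideal (colon a b).
Proof.
have [P0 PD PM] := principal_ideal a.
split; rewrite /colon /=; first by rewrite mul0r.
- by move=> x y; rewrite mulrDl; apply: PD.
- by move=> c x; rewrite -mulrA; apply: PM.
Qed.

Lemma ideal_unit I u : is_ideal I -> u \is a GRing.unit -> I u -> I = setT.
Proof.
move=> [_ _ IM] uu Iu; apply/seteqP; split=> // x _.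
by rewrite -[x](mulrVK uu); apply: IM.
Qed.

Lemma prime_ideal_unit I u : prime_ideal I -> I u -> u \isn't a GRing.unit.
Proof. by move=> [Iid It _] Iu; apply/negP=> uu; apply/It/(ideal_unit Iid uu Iu). Qed.

Lemma prime_ideal_exp I t n : prime_ideal I -> I (t ^+ n) -> I t.
Proof.
move=> PI; elim: n => [|n IHn].
  by move/(prime_ideal_unit PI); rewrite expr0 unitr1.
by rewrite exprS; case: PI => _ _ PIM /PIM [].
Qed.

Lemma generated_comb (s : seq R) x :
  smallest (@is_ideal R) [set` s] x ->
  exists c : 'I_(size s) -> R, x = \sum_i c i * s`_i.
Proof.
pose S : set R := [set y | exists c : 'I_(size s) -> R, y = \sum_i c i * s`_i].
apply: (@smallest_sub _ _ _ S); rewrite /S /=.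
  split.
  - by exists (fun=> 0); rewrite big1 // => i _; rewrite mul0r.
  - move=> _ _ [c ->] [d ->]; exists (fun i => c i + d i).
    by rewrite -big_split; apply: eq_bigr => i _; rewrite mulrDl.
  - move=> a _ [c ->]; exists (fun i => a * c i).
    by rewrite mulr_sumr; apply: eq_bigr => i _; rewrite mulrA.
move=> y /= ys; have lt_ys : (index y s < size s)%N by rewrite index_mem.
exists (fun i => (i == Ordinal lt_ys)%:R).
rewrite (bigD1 (Ordinal lt_ys)) //= eqxx mul1r nth_index // big1 ?addr0 //.
by move=> i /negPf ->; rewrite mul0r.
Qed.

Lemma noetherian_principal :
  (forall I, is_ideal I -> exists a, I = principal a) -> noetherian R.
Proof.
move=> prR I Iid; have [a ->] := prR I Iid.
exists [:: a]; apply/seteqP; split.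
  move=> _ [c ->] J [[_ _ JM] aJ].
  by apply: JM; apply: aJ; rewrite /= inE.
apply: smallest_sub; first exact: principal_ideal.
by move=> x; rewrite /= inE => /eqP ->; exists 1; rewrite mul1r.
Qed.

(** Only finitely many elements have to be caught, so one member of the chain
    is large enough; [I] is there for the empty sequence. *)
Lemma chain_seq (F : set (set R)) I (s : seq R) :
  total_on F subset -> F I -> [set` s] `<=` \bigcup_(J in F) J ->
  exists2 J, F J & [set` s] `<=` J.
Proof.
move=> totF FI; elim: s => [|x s IHs] sF.
  by exists I => // x; rewrite /= in_nil.
have [J FJ sJ] : exists2 J, F J & [set` s] `<=` J.
  by apply: IHs => y ys; apply: sF; rewrite /= inE (ys : y \in s) orbT.
have [K FK Kx] : (\bigcup_(J in F) J) x by apply: sF; rewrite /= inE eqxx.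
have [JK|KJ] := totF _ _ FJ FK.
- exists K => // y; rewrite /= inE => /predU1P[->//|ys].
  exact/JK/sJ.
- exists J => // y; rewrite /= inE => /predU1P[->|ys]; first exact: KJ.
  exact: sJ.
Qed.

(** The maximal condition follows from Zorn's lemma: the union of a chain in
    [F] is an ideal, its finitely many generators all lie in one member of the
    chain, and the union is that member. *)
Lemma noetherian_max (F : set (set R)) I0 :
  noetherian R -> (forall I, F I -> is_ideal I) -> F I0 ->
  exists2 M, F M & forall J, F J -> M `<=` J -> J = M.
Proof.
move=> noeR Fid FI0.
(* [Zorn_bigcup] also asks for the union of the empty chain, which is [set0];
   this set is never an ideal, and so never the maximal element found. *)
pose P : set (set R) := [set I | I = set0 \/ F I].
have [|M [PM maxM]] := @Zorn_bigcup _ P.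
  move=> G GP totG.
  have [[I [GI [x Ix]]]|G0] := pselect (exists I, G I /\ I !=set0); last first.
    left; apply/seteqP; split=> // x [I GI Ix]; case: G0.
    by exists I; split=> //; exists x.
  right; pose G' := [set J | G J /\ F J].
  have FI : F I by case: (GP _ GI) => // I0'; rewrite I0' in Ix.
  have totG' : total_on G' subset by move=> J K [GJ _] [GK _]; apply: totG.
  have eG : \bigcup_(J in G) J = \bigcup_(J in G') J.
    apply/seteqP; split=> y [J]; last by case=> GJ _ Jy; exists J.
    by move=> GJ Jy; exists J => //; split=> //; case: (GP _ GJ) => // J0; rewrite J0 in Jy.
  have Uid : is_ideal (\bigcup_(J in G') J).
    split.
    - by exists I => //; case: (Fid _ FI).
    - move=> y z [J G'J Jy] [K G'K Kz].
      have [JK|KJ] := totG' _ _ G'J G'K.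
      + exists K => //; have [_ KD _] := Fid _ G'K.2; apply: KD => //; exact: JK.
      + exists J => //; have [_ JD _] := Fid _ G'J.2; apply: JD => //; exact: KJ.
    - move=> a y [J G'J Jy]; exists J => //.
      by have [_ _ JM] := Fid _ G'J.2; apply: JM.
  have [s eU] := noeR _ Uid.
  have [|J [GJ FJ] sJ] := @chain_seq G' I s totG' (conj GI FI).
    by rewrite eU; apply: sub_gen_smallest.
  suff -> : \bigcup_(J in G) J = J by [].
  rewrite eG; apply/seteqP; split; last by move=> y Jy; exists J.
  by rewrite eU; apply: smallest_sub => //; apply: Fid.
have FM : F M.
  case: PM => // M0; exfalso; apply: (maxM I0); last by right.
  rewrite M0; split; first by move=> x.
  by move=> sub0; have [I00 _ _] := Fid _ FI0; apply: (sub0 0).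
exists M => // J FJ MJ; apply/seteqP; split=> //; apply: contrapT => nJM.
by apply: (maxM J); [split|right].
Qed.

End Ideals.

(** * Fractions *)

Section Fractions.
Variable R : idomainType.
Local Notation "x %:F" := (@tofrac R x).

Lemma fraction_ratio (x : {fraction R}) :
  exists2 b, b != 0 & exists a, x = a%:F / b%:F.
Proof.
elim/quotW: x => x; exists (\d_x); first exact: denom_ratioP.
exists (\n_x); have dx0 : (\d_x)%:F != 0 by rewrite tofrac_eq0 denom_ratioP.
apply: (canRL (mulfK dx0)); unlock tofrac; rewrite -[LHS]FracField.pi_mul.
apply/eqmodP; rewrite /= FracField.equivfE /FracField.mulf.
by rewrite !numden_Ratio ?(oner_eq0, mulf_neq0, denom_ratioP) // !mulr1 mulrC.
Qed.

Lemma tofrac_inj : injective (@tofrac R).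
Proof. by move=> a b /eqP; rewrite tofrac_eq => /eqP. Qed.

(** A fraction outside [R] is the inverse of some [y] in [R]. Multiplying a
    monic equation of degree [d] for [1 / y] by [y ^+ d] gives an equation
    [y * q + 1 = 0] in [R], so that [y] is a unit and [1 / y] lies in [R]. *)
Lemma integrally_closed_total :
  (forall a b : R, principal a b \/ principal b a) -> integrally_closed R.
Proof.
move=> divR x [p mon_p]; have [b b0 [a ->]] := fraction_ratio x.
have bF0 : b%:F != 0 by rewrite tofrac_eq0.
have [[c ->] | [y ba]] := divR b a.
  by move=> _; exists c => //; rewrite tofracM mulfK.
have [-> _|a0] := eqVneq a 0; first by exists 0; rewrite ?tofrac0 ?mul0r.
have y0 : y%:F != 0.
  by rewrite tofrac_eq0; apply: contraNneq b0 => y0; rewrite ba y0 mul0r.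
have -> : a%:F / b%:F = y%:F^-1.
  by rewrite ba tofracM invfM mulrCA divff ?mulr1 // tofrac_eq0.
move=> /rootP; rewrite horner_coef (size_map_inj_poly tofrac_inj) ?tofrac0 //.
have [d ed] : exists d, size p = d.+1.
  by exists (size p).-1; rewrite prednK // size_poly_gt0 monic_neq0.
rewrite ed => /(congr1 ( *%R (y%:F ^+ d))); rewrite mulr0 big_ord_recr /=.
rewrite !coef_map /= -[d]/(d.+1.-1) -ed -lead_coefE (monicP mon_p) tofrac1 mul1r ed /=.
rewrite mulrDr exprVn divff ?expf_neq0 // mulr_sumr => e.
have {}e : \sum_(i < d) p`_i * y ^+ (d - i.+1) * y + 1 = 0.
  apply/eqP; rewrite -(@tofrac_eq R) tofrac0 -e tofracD tofrac1; apply/eqP.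
  congr (_ + 1); rewrite rmorph_sum; apply: eq_bigr => i _.
  rewrite coef_map /= mulrCA -mulrA -exprSr subnSK // tofracM tofracXn exprVn.
  congr (_ * _); rewrite -[X in _ ^+ X / _](subnK (ltnW (ltn_ord i))) exprD mulfK //.
  exact: expf_neq0.
have yu : y \is a GRing.unit.
  apply/unitrPr; exists (- \sum_(i < d) p`_i * y ^+ (d - i.+1)).
  by rewrite mulrN mulrC mulr_suml; apply/eqP; rewrite eq_sym -addr_eq0 addrC e.
by exists y^-1 => //; rewrite rmorphV.
Qed.

End Fractions.

(** * Rings with a uniformizer *)

Definition uniformizer (R : comUnitRingType) (t : R) : Prop :=
  [/\ t != 0, t \isn't a GRing.unit
    & forall x, x != 0 ->
        exists n, exists2 u, u \is a GRing.unit & x = u * t ^+ n].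

Section Uniformizer.
Variables (R : idomainType) (t : R).
Hypothesis unif_t : uniformizer t.

Let t_neq0 : t != 0. Proof. by case: unif_t. Qed.
Let t_nunit : t \isn't a GRing.unit. Proof. by case: unif_t. Qed.

Lemma uniformizer_expr_unit n : t ^+ n \is a GRing.unit -> n = 0%N.
Proof. by case: n => // n; rewrite unitrX_pos // (negPf t_nunit). Qed.

Lemma uniformizer_total (a b : R) : principal a b \/ principal b a.
Proof.
have [_ _ fact] := unif_t.
have [->|/fact[m [u uu ->]]] := eqVneq a 0.
  by right; exists 0; rewrite mul0r.
have [->|/fact[n [w wu ->]]] := eqVneq b 0.
  by left; exists 0; rewrite mul0r.
wlog le_mn : m n u w uu wu / (m <= n)%N.
  move=> IH; have [/IH|/ltnW/IH] := leqP m n; first exact.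
  by case/(_ w u)=> // ?; [right|left].
left; exists (w * t ^+ (n - m) * u^-1).
by rewrite mulrA mulrVK // -mulrA -exprD subnK.
Qed.

(** A nonzero ideal is generated by the least power of [t] that it contains. *)
Lemma uniformizer_pid (I : set R) : is_ideal I -> exists a, I = principal a.
Proof.
move=> Iid; have [_ _ fact] := unif_t; have [I0 _ IM] := Iid.
have [allI0|] := pselect (forall x, I x -> x = 0).
  exists 0; apply/seteqP; split=> x; last by case=> c ->; rewrite mulr0.
  by move/allI0=> ->; exists 0; rewrite mulr0.
move=> /existsNP[x /not_implyP[Ix /eqP x0]].
have genI y : I y -> y != 0 -> exists2 n, I (t ^+ n) & principal (t ^+ n) y.
  move=> Iy /fact[n [u uu ey]]; exists n; last by exists u.
  by rewrite -(mulKr uu (t ^+ n)) -ey; apply: IM.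
have exn : exists n, `[< I (t ^+ n) >].
  by have [n In _] := genI _ Ix x0; exists n; apply/asboolP.
case: (ex_minnP exn) => n /asboolP In minn; exists (t ^+ n).
apply/seteqP; split; last exact: principal_sub.
move=> y Iy; have [->|y0] := eqVneq y 0.
  by exists 0; rewrite mul0r.
have [m Im [c ->]] := genI _ Iy y0.
have le_nm : (n <= m)%N by apply/minn/asboolP.
by exists (c * t ^+ (m - n)); rewrite -mulrA -exprD subnK.
Qed.

Lemma uniformizer_nunit x : x \isn't a GRing.unit -> principal t x.
Proof.
have [_ _ fact] := unif_t; have [->|x0] := eqVneq x 0.
  by exists 0; rewrite mul0r.
have [[|n] [u uu ->]] := fact x x0; first by rewrite mulr1 uu.
by move=> _; exists (u * t ^+ n); rewrite -mulrA -exprSr.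
Qed.

Lemma uniformizer_principal_nunit x : principal t x -> x \isn't a GRing.unit.
Proof. by case=> c ->; rewrite unitrM negb_and t_nunit orbT. Qed.

Lemma uniformizer_maximal : maximal_ideal (principal t).
Proof.
split; first exact: principal_ideal.
  move=> tT; have : principal t 1 by rewrite tT.
  by move/uniformizer_principal_nunit; rewrite unitr1.
move=> J Jid tJ; have [Jt|] := pselect (J `<=` principal t).
  by left; apply/seteqP.
move=> /existsNP[x /not_implyP[Jx ntx]]; right.
apply: (ideal_unit Jid _ Jx); apply: contra_notT ntx; exact: uniformizer_nunit.
Qed.

Lemma uniformizer_prime : prime_ideal (principal t).
Proof.
have [tid tT _] := uniformizer_maximal; split=> // x y /uniformizer_principal_nunit.
rewrite unitrM negb_and => /orP[/uniformizer_nunit|/uniformizer_nunit]; by [left|right].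
Qed.

(** A nonzero prime contains some unit times [t ^+ n], hence [t]; and it
    contains only nonunits, which are the multiples of [t]. *)
Lemma uniformizer_prime_unique (P : set R) :
  prime_ideal P -> P <> [set 0] -> P = principal t.
Proof.
move=> Ppr P0; have [Pid PT _] := Ppr; have [P00 _ PM] := Pid.
apply/seteqP; split=> [x /(prime_ideal_unit Ppr)|].
  exact: uniformizer_nunit.
apply: principal_sub => //.
have [x Px /eqP x0] : exists2 x, P x & x <> 0.
  apply: contrapT => nP; apply: P0; apply/seteqP; split=> [x Px|_ ->//].
  by apply: contrapT => x0; apply: nP; exists x.
have [_ _ /(_ _ x0)[n [u uu ex]]] := unif_t.
apply: (prime_ideal_exp (n := n) Ppr).
by rewrite -(mulKr uu (t ^+ n)) -ex; apply: PM.
Qed.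

Lemma uniformizer_dedekind_local :
  dedekind_domain R /\ (exists! P : set R, prime_ideal P /\ P <> [set 0]).
Proof.
split.
  split.
  - exact/noetherian_principal/uniformizer_pid.
  - exact/integrally_closed_total/uniformizer_total.
  - move=> P Ppr P0; rewrite (uniformizer_prime_unique Ppr P0).
    exact: uniformizer_maximal.
exists (principal t); split; last by move=> P [Ppr /(uniformizer_prime_unique Ppr)].
split; first exact: uniformizer_prime.
move=> t0; have : principal t t by exists 1; rewrite mul1r.
by rewrite t0; apply/eqP.
Qed.

End Uniformizer.
(** * Discrete valuation rings and uniformizers *)

Section Valuation.
Variables (K : fieldType) (v : K -> int).
Hypothesis val_v : discrete_valuation v.

Lemma valuationM x y : x != 0 -> y != 0 -> v (x * y) = v x + v y.
Proof. by case: val_v => + _ _; apply. Qed.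

Lemma valuation1 : v 1 = 0.
Proof.
have := valuationM (oner_neq0 K) (oner_neq0 K); rewrite mulr1.
by rewrite -[X in X = _]addr0 => /addrI.
Qed.

Lemma valuationV x : x != 0 -> v x^-1 = - v x.
Proof.
move=> x0; apply/eqP; rewrite -addr_eq0 -valuationM ?invr_eq0 //.
by rewrite mulVf // valuation1.
Qed.

Lemma valuationX x n : x != 0 -> v (x ^+ n) = v x *+ n.
Proof.
move=> x0; elim: n => [|n IHn]; first by rewrite expr0 valuation1.
by rewrite exprS mulrS valuationM ?IHn ?expf_neq0.
Qed.

End Valuation.

(** The elements of value 0 are the units, because their inverses have value 0
    too; an element [x] of value [n] is therefore a unit times [t ^+ n] as soon
    as [t] has value 1. *)
Lemma dvr_uniformizer (R : idomainType) :
  is_dvr R -> exists t : R, uniformizer t.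
Proof.
move=> [K [v [f [val_v f_inj rf]]]]; have [_ v_surj _] := val_v.
have f_neq0 x : x != 0 -> f x != 0.
  by apply: contra_neq => fx0; apply: f_inj; rewrite fx0 rmorph0.
have fP y : 0 <= v y -> exists x, f x = y.
  move=> vy; have : valuation_ring v y by right.
  by rewrite -rf => -[x _ <-]; exists x.
have vf_ge0 x : x != 0 -> 0 <= v (f x).
  move=> /f_neq0 fx0; have : valuation_ring v (f x) by rewrite -rf; exists x.
  by case=> // /eqP; rewrite (negPf fx0).
have unit_v0 x : x != 0 -> v (f x) = 0 -> x \is a GRing.unit.
  move=> x0 vx; have [|y fy] := fP (f x)^-1.
    by rewrite (valuationV val_v) ?f_neq0 // vx oppr0.
  apply/unitrPr; exists y; apply: f_inj.
  by rewrite rmorphM fy rmorph1 divff ?f_neq0.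
have [z z0 vz] := v_surj 1; have [|t ft] := fP z; first by rewrite vz.
have t0 : t != 0 by apply: contraNneq z0 => t0; rewrite -ft t0 rmorph0.
exists t; split=> // [|x x0].
  apply/negP=> tu; have := vf_ge0 t^-1; rewrite invr_neq0 // => /(_ isT).
  by rewrite rmorphV // (valuationV val_v) ?f_neq0 // ft vz.
have [n vx] : exists n : nat, v (f x) = n.
  by exists `|v (f x)|%N; rewrite gez0_abs ?vf_ge0.
have tn0 : f t ^+ n != 0 by rewrite expf_neq0 ?f_neq0.
have vq : v (f x / f t ^+ n) = 0.
  rewrite (valuationM val_v) ?invr_eq0 ?f_neq0 // (valuationV val_v) //.
  by rewrite (valuationX val_v) ?f_neq0 // ft vz vx natz subrr.
have [|u fu] := fP (f x / f t ^+ n); first by rewrite vq.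
have ex : x = u * t ^+ n by apply: f_inj; rewrite rmorphM fu rmorphXn mulfVK.
exists n, u => //; apply: unit_v0; last by rewrite fu.
by apply: contraNneq x0 => u0; rewrite ex u0 mul0r.
Qed.

Section UniformizerValuation.
Variables (R : idomainType) (t : R).
Hypothesis unif_t : uniformizer t.
Local Notation "x %:F" := (@tofrac R x).

Let tF_neq0 : t%:F != 0. Proof. by case: unif_t; rewrite tofrac_eq0. Qed.

(** The order is first a relation, so that its functional form can be chosen
    afterwards without a decision procedure for units and divisibility. *)
Definition has_order (x : {fraction R}) (n : int) : Prop :=
  exists2 u, u \is a GRing.unit & x = u%:F * t%:F ^ n.

Definition order (x : {fraction R}) : int := xget 0 [set n | has_order x n].

(** If [u * t ^ m = w * t ^ (m + k)] with [u] and [w] units, then [t ^+ k] is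
    a unit. *)
Lemma has_order_inj x m n : has_order x m -> has_order x n -> m = n.
Proof.
wlog le_mn : m n / m <= n.
  move=> IH xm xn; have [/IH|/IH] := orP (le_total m n); first exact.
  by move=> ->.
move=> [u uu ->] [w wu /eqP]; have [k ->] : exists k : nat, n = m + k.
  by exists `|n - m|%N; rewrite gez0_abs ?subr_ge0 // subrKC.
rewrite expfzDr // [u%:F * _]mulrC mulrCA.
rewrite (inj_eq (mulfI (expfz_neq0 m tF_neq0))) -exprnP -tofracXn -tofracM tofrac_eq.
move=> /eqP euw; have : t ^+ k \is a GRing.unit by move: uu; rewrite euw unitrM wu.
by move/(uniformizer_expr_unit unif_t)=> ->; rewrite addr0.
Qed.

Lemma orderE x n : has_order x n -> order x = n.
Proof. by move=> xn; apply: xget_unique => // m /has_order_inj; apply. Qed.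

Lemma has_order_tofrac a : a != 0 -> exists n : nat, has_order a%:F n.
Proof.
have [_ _ fact] := unif_t; move=> /fact[n [u uu ->]]; exists n, u => //.
by rewrite tofracM tofracXn.
Qed.

Lemma has_orderM x y m n :
  has_order x m -> has_order y n -> has_order (x * y) (m + n).
Proof.
move=> [u uu ->] [w wu ->]; exists (u * w); first by rewrite unitrM uu.
by rewrite tofracM expfzDr // mulrACA.
Qed.

Lemma has_orderV x n : has_order x n -> has_order x^-1 (- n).
Proof.
move=> [u uu ->]; exists u^-1; first by rewrite unitrV.
by rewrite rmorphV // invfM -invr_expz.
Qed.

Lemma has_order_order x : x != 0 -> has_order x (order x).
Proof.
move=> x0; apply: (@xgetPex _ 0 [set n | has_order x n]).
have [b b0 [a ex]] := fraction_ratio x.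
have a0 : a != 0 by apply: contraNneq x0 => a0; rewrite ex a0 tofrac0 mul0r.
have [[m am] [n bn]] := (has_order_tofrac a0, has_order_tofrac b0).
by exists (m%:Z - n%:Z); rewrite ex; apply/has_orderM/has_orderV.
Qed.

(** For the ultrametric inequality, factor out the smaller power of [t]: the
    cofactor is in [R], so its order is nonnegative. *)
Lemma order_valuation : discrete_valuation order.
Proof.
split.
- by move=> x y x0 y0; apply/orderE/has_orderM; apply: has_order_order.
- move=> n; exists (t%:F ^ n); first exact: expfz_neq0.
  by apply: orderE; exists 1; rewrite ?unitr1 // tofrac1 mul1r.
move=> x y; wlog le_xy : x y / order x <= order y.
  move=> IH x0 y0 xy0; have [/IH|/IH] := orP (le_total (order x) (order y)); first exact.
  by rewrite minC addrC; apply; rewrite // addrC.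
move=> x0 y0 xy0; rewrite min_l //.
have [[u uu ex] [w wu ey]] := (has_order_order x0, has_order_order y0).
have [k ek] : exists k : nat, order y = order x + k.
  by exists `|order y - order x|%N; rewrite gez0_abs ?subr_ge0 // subrKC.
have exy : x + y = (u + w * t ^+ k)%:F * t%:F ^ order x.
  rewrite {1}ex {1}ey ek expfzDr // -exprnP tofracD tofracM tofracXn mulrDl.
  by rewrite -mulrA [_ ^ _ * _]mulrC.
have s0 : u + w * t ^+ k != 0.
  by apply: contraNneq xy0 => s0; rewrite exy s0 tofrac0 mul0r.
have [l sl] := has_order_tofrac s0.
have tx : has_order (t%:F ^ order x) (order x).
  by exists 1; rewrite ?unitr1 // tofrac1 mul1r.
by rewrite exy (orderE (has_orderM sl tx)) lerDr.
Qed.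

Lemma uniformizer_dvr : is_dvr R.
Proof.
exists {fraction R}, order, (@tofrac R); split.
- exact: order_valuation.
- exact: tofrac_inj.
apply/seteqP; split=> [_ [a _ <-]|x [->|]].
- have [->|/has_order_tofrac[n /orderE an]] := eqVneq a 0.
    by left; apply: rmorph0.
  by right; rewrite /= an.
- by exists 0; rewrite ?tofrac0.
have [->|/has_order_order[u uu ex]] := eqVneq x 0; first by exists 0; rewrite ?tofrac0.
case: (order x) ex => // n ex _; exists (u * t ^+ n) => //.
by rewrite ex -[LHS]/((u * t ^+ n)%:F) tofracM tofracXn.
Qed.

End UniformizerValuation.

(** * Local Dedekind domains *)

Section LocalDedekind.
Variable R : idomainType.
Local Notation "x %:F" := (@tofrac R x).

(** If [x * y] is in [(a : b)] and [y] is not, then [(a : y * b)] is in the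
    family and contains [(a : b)]; by maximality they agree, and [x] belongs to
    the former. *)
Lemma colon_prime (a b : R) :
  ~ principal a b ->
  (forall c, ~ principal a c -> colon a b `<=` colon a c ->
     colon a c = colon a b) ->
  prime_ideal (colon a b).
Proof.
move=> nab maxb; split; first exact: colon_ideal.
  move=> eT; have : colon a b 1 by rewrite eT.
  by rewrite /colon /= mul1r.
move=> x y xy; have [yP|ny] := pselect (colon a b y); [by right|left].
rewrite -(maxb (y * b)) //; first by move: xy; rewrite /colon /= mulrA.
have [_ _ PM] := principal_ideal a.
by move=> z zb; rewrite /colon /= mulrCA; apply: PM.
Qed.

(** Multiplication by [b / a] maps the ideal [I] into itself. On generators of
    [I] it is given by a matrix over [R], of which [b / a] is an eigenvalue, the
    row of generators being an eigenvector; it is nonzero as [I] is. The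
    characteristic polynomial is the monic equation sought. *)
Lemma integral_stable (I : set R) (s : seq R) (a b : R) :
  I = smallest (@is_ideal R) [set` s] -> I <> [set 0] -> is_ideal I ->
  a != 0 -> (forall x, I x -> exists2 y, I y & b * x = a * y) ->
  integralOver (@tofrac R) (b%:F / a%:F).
Proof.
move=> eI I0 Iid a0 stab.
have sI i : I s`_i.
  have [lt_is|ge_is] := ltnP i (size s); last by rewrite nth_default //; case: Iid.
  by rewrite eI; apply: sub_gen_smallest; rewrite /= mem_nth.
have /choice[c cP] (j : 'I_(size s)) : exists cj : 'I_(size s) -> R,
    b * s`_j = a * \sum_i cj i * s`_i.
  have [y Iy ->] := stab _ (sI j); move: Iy; rewrite eI => /generated_comb[cj ->].
  by exists cj.
pose A : 'M[R]_(size s) := \matrix_(i, j) c j i.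
exists (char_poly A); first exact: char_poly_monic.
rewrite map_char_poly -eigenvalue_root_char; apply/eigenvalueP.
have aF0 : a%:F != 0 by rewrite tofrac_eq0.
exists (\row_i (s`_i)%:F).
  apply/rowP=> j; rewrite !mxE mulrAC -tofracM cP tofracM mulrC mulKf //.
  by rewrite rmorph_sum; apply: eq_bigr => i _; rewrite !mxE -tofracM mulrC.
apply/negP=> /eqP/rowP s0; apply: I0; apply/seteqP; split; last first.
  by move=> _ ->; case: Iid.
move=> x; rewrite eI => /generated_comb[d ->]; rewrite big1 // => i _.
by have /eqP := s0 i; rewrite !mxE tofrac_eq0 => /eqP ->; rewrite mulr0.
Qed.

(** Among the principal ideals [(y)] with [y] nonzero and not a unit times a
    power of [t], take a maximal one. Then [y] is a nonunit, so [y = t * z],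
    and [z] does not factor either. So [(z)] equals [(y)], which makes [t] a
    unit. *)
Lemma principal_factor (t : R) :
  noetherian R -> t != 0 -> t \isn't a GRing.unit ->
  (forall x, x \isn't a GRing.unit -> principal t x) -> uniformizer t.
Proof.
move=> noeR t0 tu tP; split=> // x x0; apply: contrapT => nx.
pose bad x := x != 0 /\
  ~ exists n, exists2 u, u \is a GRing.unit & x = u * t ^+ n.
pose F : set (set R) := [set I | exists2 y, bad y & I = principal y].
have [||_ [y [y0 ny] ->] maxy] := @noetherian_max R F (principal x) noeR.
- by move=> _ [y _ ->]; apply: principal_ideal.
- by exists x.
have [yu|/tP[z ey]] := boolP (y \is a GRing.unit).
  by apply: ny; exists 0%N, y; rewrite // mulr1.
have z0 : z != 0 by apply: contraNneq y0 => z0; rewrite ey z0 mul0r.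
have nz : bad z.
  split=> // -[n [u uu ez]]; apply: ny; exists n.+1, u => //.
  by rewrite ey ez -mulrA -exprSr.
have yz : principal y `<=` principal z.
  by move=> _ [c ->]; exists (c * t); rewrite -mulrA [t * z]mulrC -ey.
have : principal y z.
  by rewrite -(maxy _ _ yz); [exists 1; rewrite mul1r|exists z].
move=> [c ez]; case/negP: tu; apply/unitrPr; exists c.
by apply: (mulfI z0); rewrite mulrA -ey mulrC -ez mulr1.
Qed.

Lemma dedekind_local_uniformizer :
  dedekind_domain R -> (exists! P : set R, prime_ideal P /\ P <> [set 0]) ->
  exists t : R, uniformizer t.
Proof.
move=> [noeR icR _] [M [[Mpr M0] Muniq]]; have [Mid _ _] := Mpr.
(* [principal_factor] needs all nonunits in [M]; the same argument also
   presents [M] as a colon ideal. *)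
have colonM a : a != 0 -> a \isn't a GRing.unit ->
    M a /\ exists2 b, ~ principal a b & M = colon a b.
  move=> a0 au.
  pose F : set (set R) := [set I | exists2 b, ~ principal a b & I = colon a b].
  have [||_ [b nab ->] maxb] := @noetherian_max R F (colon a 1) noeR.
  - by move=> _ [b _ ->]; apply: colon_ideal.
  - exists 1 => // -[c /esym ec]; case/negP: au; apply/unitrPr; exists c.
    by rewrite mulrC.
  have aa : colon a b a by exists b; rewrite mulrC.
  have eM : M = colon a b.
    apply: Muniq; split; last first.
      by move=> e0; move: aa; rewrite e0 => /eqP; rewrite (negPf a0).
    by apply: colon_prime => // c nac; apply: maxb; exists c.
  by rewrite eM; split=> //; exists b.
have M_nunit x : x \isn't a GRing.unit -> M x.
  have [->|x0 /(colonM x x0)[]//] := eqVneq x 0.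
  by case: Mid.
have [a Ma /eqP a0] : exists2 a, M a & a <> 0.
  apply: contrapT => nM; apply: M0; apply/seteqP; split=> [x Mx|_ ->].
    by apply: contrapT => x0; apply: nM; exists x.
  by case: Mid.
have [_ [b nab eM]] := colonM a a0 (prime_ideal_unit Mpr Ma).
have b0 : b != 0.
  by apply/eqP=> b0; apply: nab; exists 0; rewrite b0 mul0r.
(* The unit [w] is [(b / a) * t]. *)
have [t [w [Mt wu etw]]] :
    exists t w, [/\ M t, w \is a GRing.unit & b * t = a * w].
  apply: contrapT => nt; have [s eMs] := noeR _ Mid.
  have /icR[c _ ec] : integralOver (@tofrac R) (b%:F / a%:F).
    apply: (integral_stable eMs) => // x Mx.
    have [y ey] : colon a b x by rewrite -eM.
    exists y; last by rewrite mulrC ey mulrC.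
    apply: M_nunit; apply/negP => yu; apply: nt; exists x, y; split=> //.
    by rewrite mulrC ey mulrC.
  apply: nab; exists c; apply/tofrac_inj; rewrite tofracM ec divfK //.
  by rewrite tofrac_eq0.
exists t; apply: principal_factor => //.
- apply: contraTneq wu => t0; move/eqP: etw; rewrite t0 mulr0 eq_sym.
  by rewrite mulf_eq0 (negPf a0) => /eqP ->; rewrite unitr0.
- exact: prime_ideal_unit Mpr Mt.
move=> x /M_nunit; rewrite eM => -[c ec]; have [q eq] : exists q, c = q * w.
  by exists (c / w); rewrite mulrVK.
exists q; apply: (mulfI b0).
by rewrite mulrC ec eq mulrCA etw -mulrA [w * a]mulrC.
Qed.

End LocalDedekind.

Theorem theorem13 (R : idomainType) :
  is_dvr R <->
  dedekind_domain R /\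
  (exists! P : set R, prime_ideal P /\ P <> [set 0]).
Proof.
split=> [/dvr_uniformizer[t unif_t]|[dedR uniqR]].
  exact: uniformizer_dedekind_local unif_t.
have [t unif_t] := dedekind_local_uniformizer dedR uniqR.
exact: uniformizer_dvr unif_t.
Qed.
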